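(* Let $f:\mathbb{T}^{\infty}\to\mathbb{R}$ be a measurable function that is Lipschitz with respect to the Euclidean metric $\mathrm{dist}$. Then there exists $a\in\mathbb{R}$ with the following property: for every $\varepsilon>0$ there exists a parallel infinite-dimensional subtorus $M\subseteq\mathbb{T}^{\infty}$ such that $\|f-a\|_{L^{\infty}(M)}<\varepsilon$.
   Context: $\mathbb{T}=\mathbb{R}/\mathbb{Z}$ and $\mathbb{T}^{\infty}=\mathbb{T}^{\mathbb{N}}$ is the set of sequences $x=(x_i)_{i\ge1}$ with $x_i\in\mathbb{T}$. Let $\sigma$ be the uniform probability measure on $\mathbb{T}^{\infty}$ (the complete product of Lebesgue/Haar probability measures on the circle); ''measurable'' refers to $\sigma$. For $x,y\in\mathbb{T}^\infty$, $\mathrm{dist}(x,y)=\sqrt{\sum_{i\ge1}\mathrm{dist}^2(x_i,y_i)}$, where $\mathrm{dist}(x_i,y_i)$ is the distance in the circle $\mathbb{R}/\mathbb{Z}$; this may equal $+\infty$. $f$ is Lipschitz if $|f(x)-f(y)|\le L\,\mathrm{dist}(x,y)$ for some $L$ and all $x,y$. A parallel infinite-dimensional subtorus is a set $M=\{x\in\mathbb{T}^\infty:\ x_i=b_i \text{ for all } i\in\mathbb{N}\setminus A\}$ for some infinite $A\subseteq\mathbb{N}$ and some $b:\mathbb{N}\setminus A\to\mathbb{T}$; $M$ carries its uniform (product) probability measure, with respect to which $L^\infty(M)$ is taken. *)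

(* Defs.v *)
From HB Require Import structures.
From mathcomp Require Import all_boot all_order all_algebra.
From mathcomp Require Import all_classical all_reals all_analysis.
Set Implicit Arguments. Unset Strict Implicit. Unset Printing Implicit Defensive.
Import Order.TTheory GRing.Theory Num.Theory.
Import numFieldNormedType.Exports.
Local Open Scope classical_set_scope.
Local Open Scope ring_scope.

(* The circle T = R/Z is represented by the fundamental domain [0,1);
   a point of T^oo is a sequence x : nat -> R with all x i in [0,1). *)
Section Torus.
Variable R : realType.

Definition torus : set (nat -> R) := [set x | forall i, 0 <= x i < 1].

Definition circ_dist (s t : R) : R := Num.min `|s - t| (1 - `|s - t|).

Definition tdist2 (x y : nat -> R) : \bar R :=
  (\sum_(0 <= i <oo) ((circ_dist (x i) (y i)) ^+ 2)%:E)%E.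

Definition lipschitz_torus (f : (nat -> R) -> R) : Prop :=
  exists L : R, 0 <= L /\ forall x y, torus x -> torus y ->
    ((`|f x - f y| ^+ 2)%:E <= (L ^+ 2)%:E * tdist2 x y)%E.

Definition box (n : nat) (a b : nat -> R) : set (nat -> R) :=
  [set x | torus x /\ forall i, (i < n)%N -> a i <= x i < b i].

Definition box_vol (n : nat) (a b : nat -> R) : R := \prod_(i < n) (b i - a i).

(* outer measure sigma^* of the uniform (product) probability measure on T^oo *)
Definition sigma_out (E : set (nat -> R)) : \bar R :=
  ereal_inf [set s : \bar R | exists (n : nat -> nat) (a b : nat -> nat -> R),
    (forall k i, (i < n k)%N -> 0 <= a k i /\ a k i <= b k i /\ b k i <= 1) /\
    E `<=` \bigcup_k box (n k) (a k) (b k) /\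
    s = (\sum_(0 <= k <oo) (box_vol (n k) (a k) (b k))%:E)%E].

(* sets measurable for the complete product measure sigma
   (= Caratheodory-measurable sets of sigma^* ) *)
Definition sigma_measurable (E : set (nat -> R)) : Prop :=
  E `<=` torus /\ forall F, F `<=` torus ->
    sigma_out F = (sigma_out (F `&` E) + sigma_out (F `&` ~` E))%E.

Definition sigma_null (E : set (nat -> R)) : Prop := sigma_out E = 0%E.

Definition measurable_torus (f : (nat -> R) -> R) : Prop :=
  forall r : R, sigma_measurable [set x | torus x /\ f x < r].

(* A parallel infinite-dimensional subtorus M = {x | x_i = b_i, i notin A},
   A = range e with e : nat -> nat strictly increasing (an enumeration of the
   infinite set A).  [subtorus_param e b] : T^oo -> M is the parametrisation
   y |-> x with x_(e k) = y_k and x_i = b_i for i notin A; it carries the uniform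
   measure sigma of T^oo (~ T^A) onto the uniform measure of M. *)
Definition subtorus_param (e : nat -> nat) (b y : nat -> R) : nat -> R :=
  fun i => match pselect (exists k, e k = i) with
           | left h => y (projT1 (cid h))
           | right _ => b i
           end.

Definition subtorus (e : nat -> nat) (b : nat -> R) : set (nat -> R) :=
  [set x | torus x /\ forall i, ~ (exists k, e k = i) -> x i = b i].

Definition Linf_subtorus (e : nat -> nat) (b : nat -> R) (g : (nat -> R) -> R)
  : \bar R :=
  ereal_inf [set c%:E | c in
    [set c : R | sigma_null [set y | torus y /\ c < `|g (subtorus_param e b y)|]]].

End Torus.

(* Main.v *)
(* The value [a] is an essential value of [f], obtained as an infimum of levels
   at which the distribution function of [f] has grown.  Measurability then
   gives, for each [d], a cover of the complement of
   E = {a - d <= f < a + d} by boxes of total volume less than 1.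

   The subtorus is found by derandomising this union bound.  Process the
   coordinates one at a time, allowing at each one a finite set of values (a
   singleton for the frozen coordinates, a fine net for the free ones), and
   consider the expected number of (box, admissible prefix) incidences when the
   remaining coordinates are uniform.  Averaging over one coordinate shows that
   some value does not increase this potential; freezing sufficiently many
   coordinates makes it as small as desired, so that a whole net can then be
   afforded at the next coordinate while staying below 1.  In the limit no
   admissible point lies in any box, because such an incidence would contribute
   1 at a finite stage.  Hence all admissible points lie in E, every point of
   the subtorus is at a small Euclidean distance from one of them, and the
   Lipschitz bound gives smallness of [f - a] everywhere on the subtorus. *)
Require Import Defs.
From HB Require Import structures.
From mathcomp Require Import all_boot all_order all_algebra.
From mathcomp Require Import all_classical all_reals all_analysis.
From mathcomp Require Import measurable_realfun lra.
Import Order.TTheory GRing.Theory Num.Theory.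
Local Open Scope classical_set_scope.
Local Open Scope ring_scope.

(** * Averaging over one coordinate *)

(** A series at least [eta] throughout [[p, q)] would have integral at least [eta * (q - p)]; term
    by term, the integral is at most the sum in the hypothesis, as [[l k, r k)] meets [[p, q)] in
    length at most [r k - l k]. *)
Lemma exists_point_series_lt (R : realType) (C l r : nat -> R) (p q eta : R) :
  p < q -> (forall k, 0 <= C k) -> (forall k, l k <= r k) ->
  (\sum_(0 <= k <oo) (C k * (r k - l k))%:E < (eta * (q - p))%:E)%E ->
  exists2 t, p <= t < q &
    (\sum_(0 <= k <oo) (C k * (l k <= t < r k)%R%:R)%:E < eta%:E)%E.
Proof.
move=> pq C0 lr slt; apply: contrapT => noT.
(* For [eta <= 0] the hypothesis is already absurd; the comparison of integrals below needs a
   nonnegative constant. *)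
have [eta0|eta0] := leP eta 0.
  have : (0 <= \sum_(0 <= k <oo) (C k * (r k - l k))%:E)%E.
    by apply: nneseries_ge0 => k _ _; rewrite lee_fin mulr_ge0 ?subr_ge0.
  move/le_lt_trans => /(_ _ slt); rewrite lte_fin ltNge.
  by rewrite mulr_le0_ge0 ?subr_ge0 ?(ltW pq).
pose g k (t : R) : \bar R := ((C k)%:E * (\1_(`[l k, r k[%classic : set R) t)%:E)%E.
have gE k t : (C k * (l k <= t < r k)%R%:R)%:E = g k t.
  by rewrite /g -EFinM indicE mem_setE in_itv.
have ge_eta t : `[p, q[%classic t -> (eta%:E <= \sum_(0 <= k <oo) g k t)%E.
  rewrite /= in_itv/= => tpq; rewrite leNgt; apply/negP => h.
  by apply: noT; exists t => //; under eq_eseriesr do rewrite gE.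
have mind k : measurable_fun setT (EFin \o (\1_(`[l k, r k[%classic : set R) : R -> R)).
  by apply/measurable_EFinP; exact: measurable_indic.
have mg k : measurable_fun `[p, q[ (g k).
  apply: measurable_funTS; have := measurable_funeM (C k)%:E (mind k). exact.
have g_ge0 k t : (0 <= g k t)%E.
  by rewrite -gE lee_fin mulr_ge0.
have : (\int[@lebesgue_measure R]_(t in `[p, q[) eta%:E <=
   \int[@lebesgue_measure R]_(t in `[p, q[) \sum_(0 <= k <oo) g k t)%E.
  apply: ge0_le_integral => //.
  - by move=> t _; rewrite lee_fin ltW.
  - exact: (@ge0_emeasurable_sum _ _ _ _ g xpredT).
rewrite integral_cst//= lebesgue_measure_itv/= lte_fin pq.
rewrite integral_nneseries//.
rewrite -EFinD -EFinM; apply/negP; rewrite -ltNge; apply: le_lt_trans slt.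
apply: lee_nneseries => k _; first by move=> _; apply: integral_ge0.
rewrite ge0_integralZl//=; last 2 first.
- by apply/measurable_EFinP; exact: measurable_indic.
- by rewrite lee_fin.
rewrite integral_indic//= EFinM lee_pmul//.
  by rewrite lee_fin.
apply: (@le_trans _ _ (@lebesgue_measure R `[l k, r k[)).
  by apply: le_measure; rewrite ?inE//; exact: measurableI.
rewrite lebesgue_measure_itv/= lte_fin; case: ifP => // _.
by rewrite lee_fin subr_ge0.
Qed.

(** * The potential and its evolution along the coordinates *)

Section Derandomization.
Variables (R : realType) (n : nat -> nat) (a b : nat -> nat -> R).
Hypothesis ab : forall k i, (i < n k)%N ->
  0 <= a k i /\ a k i <= b k i /\ b k i <= 1.

(* [T i] lists the values allowed at coordinate [i].  Summed over all admissible
   prefixes of length [m], the conditional volume of the [k]-th box is the product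
   of its [factor]s; coordinates [i >= n k] do not count, so a prefix extended
   beyond [n k] is not counted several times. *)
Definition factor (k m : nat) (T : nat -> seq R) (i : nat) : R :=
  if (i < m)%N then (count (fun t => a k i <= t < b k i) (T i))%:R
  else b k i - a k i.

Definition partial_vol (k m : nat) (T : nat -> seq R) : R :=
  \prod_(i < n k) factor k m T i.

Definition potential (c : nat -> R) (m : nat) (T : nat -> seq R) : \bar R :=
  (\sum_(0 <= k <oo) (c k * partial_vol k m T)%:E)%E.

Definition set_coord (T : nat -> seq R) (m : nat) (s : seq R) : nat -> seq R :=
  fun i => if i == m then s else T i.

Lemma factor_ge0 k m T i : (i < n k)%N -> 0 <= factor k m T i.
Proof.
move=> ink; rewrite /factor; case: ifP => // _.
by have [_ [+ _]] := ab _ _ ink; rewrite subr_ge0.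
Qed.

Lemma partial_vol_ge0 k m T : 0 <= partial_vol k m T.
Proof. by apply: prodr_ge0 => i _; exact: factor_ge0. Qed.

Lemma partial_vol0 k T : partial_vol k 0 T = box_vol (n k) (a k) (b k).
Proof. by []. Qed.

(** Integrality turns a potential below 1 into avoidance: a fully decided count below 1 is 0. *)
Lemma partial_vol_nat k m T : (n k <= m)%N ->
  partial_vol k m T =
  (\prod_(i < n k) count (fun t => a k i <= t < b k i)%R (T i))%:R.
Proof.
move=> nm; rewrite natr_prod; apply: eq_bigr => i _.
by rewrite /factor (leq_trans (ltn_ord i) nm).
Qed.

(* Beyond its dimension [n k] a box is unconstrained, i.e. its side is [0, 1). *)
Let lo k m : R := if (m < n k)%N then a k m else 0.
Let hi k m : R := if (m < n k)%N then b k m else 1.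
Let rest k m T := \prod_(i < n k | i != m :> nat) factor k m T i.

Let rest_ge0 k m T : 0 <= rest k m T.
Proof. by apply: prodr_ge0 => i _; exact: factor_ge0. Qed.

Let partial_volE k m T : partial_vol k m T = rest k m T * (hi k m - lo k m).
Proof.
rewrite /partial_vol /rest /hi /lo; case: ltnP => [mn|nm].
  by rewrite (bigD1 (Ordinal mn))//= mulrC {2}/factor ltnn.
rewrite subr0 mulr1; apply: eq_bigl => i; symmetry.
by rewrite neq_ltn (leq_trans (ltn_ord i) nm).
Qed.

Let partial_volS k m T s : partial_vol k m.+1 (set_coord T m s) =
  rest k m T * (if (m < n k)%N
    then (count (fun t => a k m <= t < b k m) s)%:R else 1).
Proof.
have restE i : i != m -> factor k m.+1 (set_coord T m s) i = factor k m T i.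
  move=> im; rewrite /factor /set_coord (negbTE im) ltnS leq_eqVlt.
  by rewrite (negbTE im).
rewrite /partial_vol /rest; case: ltnP => [mn|nm].
  rewrite (bigD1 (Ordinal mn))//= mulrC; congr (_ * _).
    by apply: eq_bigr => i im; exact: restE.
  by rewrite /factor ltnSn /set_coord eqxx.
rewrite mulr1; have im (i : 'I_(n k)) : i != m :> nat.
  by rewrite neq_ltn (leq_trans (ltn_ord i) nm).
by apply: eq_big => i; [rewrite im|move=> _; exact/restE/im].
Qed.

(** Since [partial_vol] is [rest] times the side length at [m], the potential is the series averaged
    in [exists_point_series_lt]. Confining [t] to [[p, q)] costs at most a factor [1 / (q - p)]. *)
Lemma exists_coordinate (c : nat -> R) m T p q eta :
  (forall k, 0 <= c k) -> 0 <= p -> p < q -> q <= 1 ->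
  (potential c m T < (eta * (q - p))%:E)%E ->
  exists2 t, p <= t < q & (potential c m.+1 (set_coord T m [:: t]) < eta%:E)%E.
Proof.
move=> c0 p0 pq q1 potT.
have lohi k : lo k m <= hi k m.
  by rewrite /lo /hi; case: ltnP => // mn; have [_ []] := ab _ _ mn.
have [||t tpq tlt] := @exists_point_series_lt R (fun k => c k * rest k m T)
  (lo ^~ m) (hi ^~ m) p q eta pq _ lohi.
- by move=> k; rewrite mulr_ge0.
- under eq_eseriesr do rewrite -mulrA -partial_volE.
  exact: potT.
exists t => //; rewrite /potential.
under eq_eseriesr => k _.
  rewrite partial_volS (_ : (if _ then _ else _) = (lo k m <= t < hi k m)%R%:R); last first.
    rewrite /lo /hi; case: ifP => //= _; first by rewrite addn0.
    case/andP: tpq => pt tq.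
    by rewrite (le_trans p0 pt) (lt_le_trans tq q1).
  rewrite mulrA; over.
exact: tlt.
Qed.

Lemma potential_ge0 c m T : (forall k, 0 <= c k) -> (0 <= potential c m T)%E.
Proof.
move=> c0; apply: nneseries_ge0 => k _ _.
by rewrite lee_fin mulr_ge0// partial_vol_ge0.
Qed.

(** Counts add up for the boxes with [m < n k]; any other box contributes once on the left but twice
    on the right, hence only an inequality. *)
Lemma potential_set_coord_cat c m T s s' : (forall k, 0 <= c k) ->
  (potential c m.+1 (set_coord T m (s ++ s')) <=
   potential c m.+1 (set_coord T m s) + potential c m.+1 (set_coord T m s'))%E.
Proof.
move=> c0; rewrite /potential -nneseriesD; last 2 first.
- by move=> k _ _; rewrite lee_fin mulr_ge0// partial_vol_ge0.
- by move=> k _ _; rewrite lee_fin mulr_ge0// partial_vol_ge0.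
apply: lee_nneseries => k _.
  by move=> _; rewrite lee_fin mulr_ge0// partial_vol_ge0.
rewrite -EFinD lee_fin -mulrDr ler_wpM2l// !partial_volS -mulrDr ler_wpM2l//.
by case: ifP => _; rewrite ?count_cat ?natrD// lerDl.
Qed.

(** One value is chosen in each of the [N] cells of length [1/N]. Confinement to a cell turns the
    bound [N^-2] into [N^-1], so the [N] choices together stay below 1. *)
Lemma exists_net m T (N : nat) : (0 < N)%N ->
  (potential (fun=> 1%R) m T < (N%:R^-1 * N%:R^-1)%:E)%E ->
  exists s : seq R, [/\ (forall t, t \in s -> 0 <= t < 1),
    (forall y, 0 <= y < 1 -> exists2 t, t \in s & `|y - t| <= N%:R^-1) &
    (potential (fun=> 1%R) m.+1 (set_coord T m s) < 1%:E)%E].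
Proof.
move=> N0 potT.
have N0' : 0 < N%:R^-1 :> R by rewrite invr_gt0 ltr0n.
have cell j : (j < N)%N -> exists2 t, j%:R / N%:R <= t < j.+1%:R / N%:R &
    (potential (fun=> 1%R) m.+1 (set_coord T m [:: t]) < (N%:R^-1)%:E)%E.
  move=> jN; apply: exists_coordinate => //.
  - by rewrite ltr_pM2r// ltr_nat.
  - by rewrite ler_pdivrMr ?ltr0n// mul1r ler_nat.
  - by rewrite -mulrBl -natrB// subSnn mul1r.
have cell01 j (t : R) : (j < N)%N -> j%:R / N%:R <= t < j.+1%:R / N%:R -> 0 <= t < 1.
  move=> jN /andP[jt tj]; apply/andP; split.
    by apply: le_trans jt; rewrite divr_ge0.
  by apply: lt_le_trans tj _; rewrite ler_pdivrMr ?ltr0n// mul1r ler_nat.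
have dist j (t y : R) : j%:R / N%:R <= t < j.+1%:R / N%:R ->
    j%:R / N%:R <= y < j.+1%:R / N%:R -> `|y - t| <= N%:R^-1 :> R.
  rewrite -natr1 mulrDl mul1r ler_norml => /andP[? ?] /andP[? ?].
  by apply/andP; split; lra.
suff H j : (j < N)%N -> exists s : seq R, [/\ (forall t, t \in s -> 0 <= t < 1),
    (forall y, 0 <= y < j.+1%:R / N%:R -> exists2 t, t \in s & `|y - t| <= N%:R^-1) &
    (potential (fun=> 1%R) m.+1 (set_coord T m s) < (j.+1%:R / N%:R)%:E)%E].
  have := H N.-1; rewrite prednK// divff ?pnatr_eq0 -?lt0n//; exact.
elim: j => [|j IH] jN.
  have [t t0 pt] := cell _ jN; exists [:: t]; split.
  - by move=> u; rewrite inE => /eqP ->; exact: cell01 t0.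
  - move=> y y0; exists t; rewrite ?inE//; apply: dist t0 _.
    by rewrite mul0r.
  - by rewrite mul1r.
have [s [s01 snet spot]] := IH (ltnW jN).
have [t t0 pt] := cell _ jN; exists (s ++ [:: t]); split.
- move=> u; rewrite mem_cat inE => /orP[/s01//|/eqP ->]; exact: cell01 t0.
- move=> y /andP[y0 yj]; have [yj'|yj'] := ltP y (j.+1%:R / N%:R).
    have [|u us yu] := snet y; first by rewrite y0.
    by exists u => //; rewrite mem_cat us.
  exists t; first by rewrite mem_cat inE eqxx orbT.
  by apply: dist t0 _; rewrite yj'.
- apply: le_lt_trans (potential_set_coord_cat _ _ _ _ _ _) _ => //.
  by rewrite -natr1 mulrDl mul1r EFinD lteD.
Qed.

Lemma partial_vol_le_potential c m T k : (forall k, 0 <= c k) ->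
  ((c k * partial_vol k m T)%:E <= potential c m T)%E.
Proof.
move=> c0; have t0 j : (0 <= (c j * partial_vol j m T)%:E)%E.
  by rewrite lee_fin mulr_ge0// partial_vol_ge0.
apply: le_trans (nneseries_lim_ge k.+1 _) => //.
by rewrite big_nat_recr//= leeDr// sume_ge0.
Qed.

(** Averaging over all of [[0, 1)] with [eta = 1] freezes one coordinate and keeps the potential
    below 1. *)
Lemma exists_prefix c m T d : (forall k, 0 <= c k) ->
  (potential c m T < 1%:E)%E -> exists T', [/\
    (forall i, (i < m)%N -> T' i = T i),
    (forall i, (m <= i < m + d)%N -> exists2 t, 0 <= t < 1 & T' i = [:: t]) &
    (potential c (m + d) T' < 1%:E)%E].
Proof.
move=> c0 potT; elim: d => [|d [T1 [agree sing potT1]]].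
  exists T; rewrite addn0; split => // i /andP[mi im].
  by move: (leq_ltn_trans mi im); rewrite ltnn.
have [||||t t01 pt] := @exists_coordinate c (m + d) T1 0 1 1 c0 => //.
  by rewrite subr0 mulr1.
exists (set_coord T1 (m + d) [:: t]); rewrite addnS; split => //.
- move=> i im; rewrite /set_coord ifN ?agree// neq_ltn.
  by rewrite (leq_trans im (leq_addr _ _)).
- move=> i /andP[mi]; rewrite ltnS leq_eqVlt /set_coord.
  case: eqP => [_ _|_ /= id]; first by exists t.
  by apply: sing; rewrite mi.
Qed.

Lemma nneseries_tail_lt (u : nat -> \bar R) tau : 0 < tau ->
  (forall k, (0 <= u k)%E) -> (\sum_(0 <= k <oo) u k < +oo)%E ->
  exists K, (\sum_(K <= k <oo) u k < tau%:E)%E.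
Proof.
move=> tau0 u0 ufin; apply: contrapT => noK.
have cvg0 := nneseries_tail_cvg ufin (fun k _ => u0 k).
have : (tau%:E <= limn (fun K => \sum_(K <= k <oo) u k))%E.
  apply: lime_ge; first by apply/cvg_ex; exists 0%E.
  by near=> K; rewrite leNgt; apply/negP => h; apply: noK; exists K.
by rewrite (cvg_lim _ cvg0)// lee_fin leNgt tau0.
Unshelve. all: by end_near. Qed.

(* All but finitely many boxes have tiny total volume; weighting those by
   [eta^-1] keeps the potential below 1.  Once the finitely many others are
   decided they contribute integers below 1, hence nothing, and dropping the
   weights leaves a potential below [eta]. *)
Lemma exists_boost m T (eta : R) : 0 < eta ->
  (potential (fun=> 1%R) m T < 1%:E)%E -> exists m' T', [/\ (m <= m')%N,
    (forall i, (i < m)%N -> T' i = T i),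
    (forall i, (m <= i < m')%N -> exists2 t, 0 <= t < 1 & T' i = [:: t]) &
    (potential (fun=> 1%R) m' T' < eta%:E)%E].
Proof.
move=> eta0 potT.
pose u k := (partial_vol k m T)%:E.
have u0 k : (0 <= u k)%E by rewrite lee_fin partial_vol_ge0.
have potE : potential (fun=> 1%R) m T = (\sum_(0 <= k <oo) u k)%E.
  by apply: eq_eseriesr => k _; rewrite mul1r.
have [p pE] : exists p, potential (fun=> 1%R) m T = p%:E.
  have := potential_ge0 (fun=> 1%R) m T (fun=> ler01).
  by case: (potential _ m T) potT => // p _ _; exists p.
move: potT; rewrite pE lte_fin => p1.
(* Divided by [eta], such a tail stays below [1 - p], the room left by the current potential [p]. *)
have [||K tailK] := @nneseries_tail_lt u (eta * (1 - p)) _ u0.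
- by rewrite mulr_gt0 ?subr_gt0.
- by rewrite -potE pE ltry.
pose c k : R := if (k < K)%N then 1 else eta^-1.
have c0 k : 0 <= c k by rewrite /c; case: ifP => // _; rewrite invr_ge0 ltW.
have potc : (potential c m T < 1%:E)%E.
  rewrite /potential (@nneseries_split _ _ 0 K); last first.
    by move=> k _; rewrite lee_fin mulr_ge0 ?partial_vol_ge0.
  rewrite add0n (_ : \sum_(0 <= k < K) _ = \sum_(0 <= k < K) u k)%E; last first.
    by apply: eq_big_nat => k /andP[_ kK]; rewrite /c kK mul1r.
  rewrite (_ : \sum_(K <= k <oo) _ = eta^-1%:E * \sum_(K <= k <oo) u k)%E; last first.
    rewrite -nneseriesZl// !(eseries_cond _ _ K); apply: eq_eseriesr => k.
    by move=> /= Kk; rewrite /c ltnNge Kk EFinM.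
  rewrite (@lt_le_trans _ _ (\sum_(0 <= k < K) u k + (1 - p)%:E)%E)//.
    rewrite lteD2lE; last by rewrite sumEFin.
    rewrite (_ : (1 - p)%:E = eta^-1%:E * (eta * (1 - p))%:E)%E.
      by rewrite lte_pmul2l// lte_fin invr_gt0.
    by rewrite -EFinM mulrA mulVf ?mul1r// gt_eqF.
  rewrite -lee_suber_addr; last by [].
  apply: le_trans (nneseries_lim_ge K _) _ => //.
  by rewrite -potE pE -EFinB lee_fin; lra.
have [T' [agree sing potT']] := exists_prefix c m T (maxn m (\max_(k < K) n k) - m)%N c0 potc.
move: sing potT'; rewrite subnKC ?leq_maxl//; set m' := maxn _ _ => sing potT'.
have vol0 k : (k < K)%N -> partial_vol k m' T' = 0.
  move=> kK; have nm' : (n k <= m')%N.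
    by rewrite leq_max (leq_bigmax (Ordinal kK)) orbT.
  have := le_lt_trans (partial_vol_le_potential c m' T' k c0) potT'.
  rewrite /c kK mul1r lte_fin partial_vol_nat//.
  by rewrite -[ltRHS]/(1%:R) ltr_nat ltnS leqn0 => /eqP ->.
exists m', T'; split=> //; first exact: leq_maxl.
apply: (@le_lt_trans _ _ (eta%:E * potential c m' T')%E); last first.
  by rewrite -[ltRHS]mule1 lte_pmul2l.
rewrite /potential -nneseriesZl; last first.
  by move=> k _; rewrite lee_fin mulr_ge0 ?partial_vol_ge0.
apply: lee_nneseries => k _.
  by move=> _; rewrite mul1r lee_fin partial_vol_ge0.
rewrite mul1r -EFinM lee_fin /c; case: ltnP => [kK|_].
  by rewrite vol0// !mulr0.
by rewrite mulrA divff ?mul1r// gt_eqF.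
Qed.

(** One round of the construction: freezing lowers the potential below [N^-2], where [N^-1 <= r],
    which pays for a net at coordinate [m']. *)
Lemma exists_stage m T (r : R) : 0 < r ->
  (potential (fun=> 1%R) m T < 1%:E)%E -> exists m' T', [/\ (m <= m')%N,
    (forall i, (i < m)%N -> T' i = T i),
    (forall i, (m <= i < m')%N -> exists2 t, 0 <= t < 1 & T' i = [:: t]),
    (forall t, t \in T' m' -> 0 <= t < 1) /\
    (forall y, 0 <= y < 1 -> exists2 t, t \in T' m' & `|y - t| <= r) &
    (potential (fun=> 1%R) m'.+1 T' < 1%:E)%E].
Proof.
move=> r0 potT; pose N := Num.bound r^-1.
have rN : r^-1 < N%:R by apply: archi_boundP; rewrite invr_ge0 ltW.
have NR0 : 0 < N%:R :> R by apply: lt_trans rN; rewrite invr_gt0.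
have N0 : (0 < N)%N by rewrite -(ltr0n R).
have Nr : N%:R^-1 <= r by rewrite -[leRHS]invrK lef_pV2 ?posrE ?invr_gt0// ltW.
have [||m' [T1 [mm' agree sing pT1]]] := @exists_boost m T (N%:R^-1 * N%:R^-1).
- by rewrite mulr_gt0 ?invr_gt0.
- by [].
have [s [s01 net pots]] := exists_net _ _ _ N0 pT1.
exists m', (set_coord T1 m' s); rewrite /set_coord eqxx; split => //.
- by move=> i im; rewrite ifN ?agree// neq_ltn (leq_trans im mm').
- move=> i /andP[mi im']; rewrite ifN; last by rewrite neq_ltn im'.
  by apply: sing; rewrite mi.
- split=> // y /net[t ts yt]; exists t => //; exact: le_trans yt Nr.
Qed.
End Derandomization.

(** * A subtorus close to points avoiding all boxes *)

Lemma circ_dist_ge0 (R : realType) (s t : R) :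
  0 <= s < 1 -> 0 <= t < 1 -> 0 <= circ_dist s t.
Proof.
move=> /andP[? ?] /andP[? ?].
rewrite /circ_dist le_min normr_ge0 subr_ge0 ler_norml.
by apply/andP; split; lra.
Qed.

Lemma exists_avoiding_subtorus (R : realType) (n : nat -> nat)
    (a b : nat -> nat -> R) (rho : R) :
  (forall k i, (i < n k)%N -> 0 <= a k i /\ a k i <= b k i /\ b k i <= 1) ->
  (\sum_(0 <= k <oo) (box_vol (n k) (a k) (b k))%:E < 1%:E)%E -> 0 < rho ->
  exists (e : nat -> nat) (b0 : nat -> R),
    [/\ (forall k, (e k < e k.+1)%N), (forall i, 0 <= b0 i < 1) &
    forall y, torus y -> exists z, [/\ torus z,
      (forall k, ~ box (n k) (a k) (b k) z) &
      (tdist2 (subtorus_param e b0 y) z <= (rho ^+ 2)%:E)%E]].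
Proof.
move=> ab vol1 rho0.
pose pot := potential R n a b (fun=> 1%R).
(* The hypotheses are premises inside the relation, so that choice yields a total [F]; where they
   fail, [(m, T)] is a dummy value. *)
pose stage (p : (nat * (nat -> seq R)) * R) (q : nat * (nat -> seq R)) :=
  0 < p.2 -> (pot p.1.1 p.1.2 < 1%:E)%E -> [/\ (p.1.1 <= q.1)%N,
    (forall i, (i < p.1.1)%N -> q.2 i = p.1.2 i),
    (forall i, (p.1.1 <= i < q.1)%N -> exists2 t, 0 <= t < 1 & q.2 i = [:: t]),
    (forall t, t \in q.2 q.1 -> 0 <= t < 1) /\
    (forall y, 0 <= y < 1 -> exists2 t, t \in q.2 q.1 & `|y - t| <= p.2) &
    (pot q.1.+1 q.2 < 1%:E)%E].
have [F FP] : {F & forall p, stage p (F p)}.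
  apply: (@choice _ _ stage) => -[[m T] r].
  have [r0|/negP r0] := boolP (0 < r); last by exists (m, T).
  have [potT|potT] := pselect (pot m T < 1%:E)%E; last by exists (m, T).
  by have [m' [T' ?]] := exists_stage _ _ _ _ ab m T r r0 potT; exists (m', T').
pose r k : R := rho / 2 ^+ k.+1.
have r0 k : 0 < r k by rewrite divr_gt0// exprn_gt0.
(* [S k] holds the number of decided coordinates and the lists; stage [k] puts its net at [e k], so
   the next one starts at [(e k).+1]. *)
pose S := fix S k := if k is k'.+1
  then let q := F (S k', r k') in (q.1.+1, q.2) else (0%N, fun=> [::]).
pose e k := (F (S k, r k)).1.
have potS k : (pot (S k).1 (S k).2 < 1%:E)%E.
  elim: k => [|k IH].
    by rewrite /pot /potential; under eq_eseriesr do rewrite mul1r partial_vol0.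
  by have [] := FP (S k, r k) (r0 k) IH.
have SS k : [/\ ((S k).1 <= e k)%N, (S k.+1).1 = (e k).+1,
    (forall i, (i < (S k).1)%N -> (S k.+1).2 i = (S k).2 i),
    (forall i, ((S k).1 <= i < e k)%N ->
      exists2 t, 0 <= t < 1 & (S k.+1).2 i = [:: t]) &
    (forall t, t \in (S k.+1).2 (e k) -> 0 <= t < 1) /\
    (forall y, 0 <= y < 1 ->
      exists2 t, t \in (S k.+1).2 (e k) & `|y - t| <= r k)].
  by have [] := FP (S k, r k) (r0 k) (potS k).
have Se k : ((S k).1 <= e k)%N by have [] := SS k.
have S1 k : (S k.+1).1 = (e k).+1 by have [] := SS k.
have e_incr k : (e k < e k.+1)%N by rewrite -S1.
have e_homo : {homo e : i j / (i < j)%N} by apply: homo_ltn => //; exact: ltn_trans.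
have S_homo : {homo (fun k => (S k).1) : i j / (i <= j)%N}.
  apply: (@homo_leq _ _ leq leqnn) => [y x z|k]; first exact: leq_trans.
  by rewrite (S1 k); apply: leqW; exact: Se.
have e_inj k k' : e k = e k' -> k = k'.
  by have [/e_homo|/e_homo|//] := ltngtP k k' => + ekk; rewrite ekk ltnn.
have S_ge k : (k <= (S k).1)%N.
  by elim: k => // k IH; rewrite S1 ltnS (leq_trans IH).
have S_stable k j i : (i < (S k).1)%N -> (S (k + j)%N).2 i = (S k).2 i.
  move=> ik; elim: j => [|j IH]; first by rewrite addn0.
  rewrite addnS -IH; have [_ _ agree _ _] := SS (k + j)%N; apply: agree.
  exact: leq_trans ik (S_homo _ _ (leq_addr _ _)).
(* Limit lists: by [S_ge] coordinate [i] is decided after [i.+1] stages, and decided lists never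
   change. *)
pose T i := (S i.+1).2 i.
have ST k i : (i < (S k).1)%N -> (S k).2 i = T i.
  move=> ik; have [ki|ki] := leqP k i.+1.
    by rewrite /T -(subnKC ki) S_stable.
  by rewrite -(subnKC (ltnW ki)) S_stable// (leq_trans _ (S_ge _)).
have S_find i : exists k, ((S k).1 <= i < (S k.+1).1)%N.
  suff: forall j, (i < (S j).1)%N -> exists k, ((S k).1 <= i < (S k.+1).1)%N.
    by apply; exact: S_ge i.+1.
  elim=> // k IH ik; have [ik'|ki] := ltnP i (S k).1; first exact: IH.
  by exists k; rewrite ki.
have net k y : 0 <= y < 1 -> exists2 t, t \in T (e k) & `|y - t| <= r k.
  by have [_ _ _ _ [_]] := SS k; rewrite ST ?S1//; exact.
have T01 i t : t \in T i -> 0 <= t < 1.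
  have [k /andP[ki ik]] := S_find i; rewrite -(ST _ _ ik).
  have [_ _ _ sing [net01 _]] := SS k.
  move: ik; rewrite S1 ltnS leq_eqVlt => /predU1P[->|ik]; first exact: net01.
  by have [|u u01 ->] := sing i; rewrite ?ki// inE => /eqP ->.
have Tsing i : ~ (exists k, e k = i) -> exists t, T i = [:: t].
  move=> ie; have [k /andP[ki ik]] := S_find i; rewrite -(ST _ _ ik).
  have [_ _ _ sing _] := SS k.
  move: ik; rewrite S1 ltnS leq_eqVlt => /predU1P[ike|ik].
    by exfalso; apply: ie; exists k.
  by have [|u u01 ->] := sing i; [rewrite ki|exists u].
(* At a frozen coordinate the head is the only allowed value. *)
pose b0 i := head 0 (T i).
have b01 i : 0 <= b0 i < 1.
  have := T01 i; rewrite /b0; case: (T i) => [|t s]; first by rewrite lexx ltr01.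
  by apply; rewrite inE eqxx.
exists e, b0; split => // y ty; set x := subtorus_param e b0 y.
have x01 i : 0 <= x i < 1.
  by rewrite /x /subtorus_param; case: pselect.
have xb i : ~ (exists k, e k = i) -> x i = b0 i.
  by rewrite /x /subtorus_param; case: pselect.
have [z zP] : {z : nat -> R & forall i, [/\ z i \in T i,
    (forall k, e k = i -> `|x i - z i| <= r k) &
    (~ (exists k, e k = i) -> z i = x i)]}.
  apply: (@choice _ _ (fun i t => [/\ t \in T i,
    (forall k, e k = i -> `|x i - t| <= r k) &
    (~ (exists k, e k = i) -> t = x i)])) => i.
  have [[k ki]|ie] := pselect (exists k, e k = i).
    have [t tT xt] := net k (x i) (x01 i); exists t; split.
    - by rewrite -ki.
    - by move=> k' k'i; have -> : k' = k by apply: e_inj; rewrite k'i ki.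
    - by case; exists k.
  exists (x i); rewrite xb//; split => //.
  - by rewrite /b0; have [t ->] := Tsing i ie; rewrite inE.
  - by move=> k ki; case: ie; exists k.
have z01 i : 0 <= z i < 1 by have [/T01] := zP i.
exists z; split => //.
  move=> k [_ zbox].
  (* After [n k] stages the box is fully decided, so its count is an integer below 1, hence 0; but
     the coordinates of [z] would make every factor positive. *)
  have := partial_vol_le_potential R n a b ab (fun=> 1) (S (n k)).1
    (S (n k)).2 k (fun=> ler01).
  move/le_lt_trans => /(_ _ (potS _)); rewrite mul1r lte_fin partial_vol_nat//.
  rewrite -[ltRHS]/(1%:R) ltr_nat ltnS leqn0 => /eqP.
  apply/eqP; rewrite -lt0n prodn_gt0// => i; rewrite -has_count.
  apply/hasP; exists (z i); last exact: zbox.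
  by rewrite ST; [have [] := zP i|exact: leq_trans (ltn_ord i) (S_ge _)].
pose d i := circ_dist (x i) (z i) ^+ 2.
have d0 i : 0 <= d i by exact: sqr_ge0.
have dr i (s : R) : 0 <= s -> `|x i - z i| <= s -> d i <= s ^+ 2.
  move=> s0 xzs; rewrite /d lerXn2r// ?nnegrE//.
    exact: circ_dist_ge0.
  by rewrite /circ_dist ge_min xzs.
have d_out i : ~ (exists k, e k = i) -> d i = 0.
  move=> ie; apply/le_anti; rewrite d0 andbT.
  have := dr i 0 (lexx 0); rewrite expr0n; apply.
  by have [_ _ ->//] := zP i; rewrite subrr normr0.
(* Stage [k] adds only the term at [e k], at most [r k ^+ 2], which is at most
   [rho ^+ 2 / 2 ^+ k.+1]: a geometric sum. *)
have dS k : \sum_(0 <= i < (S k).1) d i <= rho ^+ 2 * (1 - 2^-1 ^+ k).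
  elim: k => [|k IH]; first by rewrite big_geq// subrr mulr0.
  rewrite S1 big_nat_recr//= (big_cat_nat (leq0n _) (Se k))/=.
  have -> : \sum_((S k).1 <= i < e k) d i = 0.
    rewrite big_nat_cond big1// => i /andP[/andP[ki ik] _].
    apply: d_out => -[k' k'i].
    have [kk'|kk'|kk'] := ltngtP k k'.
    - by have := e_homo _ _ kk'; rewrite k'i ltnNge (ltnW ik).
    - by have := S_homo _ _ kk'; rewrite S1 k'i ltnNge ki.
    - by move: ik; rewrite -k'i kk' ltnn.
  rewrite addr0.
  have : d (e k) <= r k ^+ 2.
    by apply: dr; [exact: ltW|have [_ + _] := zP (e k); exact].
  have : r k ^+ 2 <= rho ^+ 2 * 2^-1 ^+ k.+1.
    rewrite /r -exprVn exprMn ler_wpM2l ?sqr_ge0//.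
    rewrite expr2 ler_piMl ?exprn_ge0 ?invr_ge0// exprn_ile1 ?invr_ge0//.
    by rewrite invf_le1// ler1n.
  rewrite [2^-1 ^+ k.+1]exprS; move: IH; set D := \sum_(0 <= i < _) _.
  set q := 2^-1 ^+ k; move: (d (e k)) (r k ^+ 2) (rho ^+ 2) => dk rk rho2.
  clearbody D q; clear; lra.
apply: lime_le; first by apply: is_cvg_nneseries => i _ _; rewrite lee_fin; exact: d0.
apply: nearW => N; rewrite sumEFin lee_fin.
apply: (@le_trans _ _ (\sum_(0 <= i < (S N).1) d i)).
  by rewrite (big_cat_nat (leq0n _) (S_ge N))/= lerDl sumr_ge0//.
by apply: le_trans (dS N) _; rewrite ler_piMr ?sqr_ge0// gerBl.
Qed.

Lemma subtorus_param_torus (R : realType) (e : nat -> nat) (b y : nat -> R) :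
  (forall i, 0 <= b i < 1) -> torus y -> torus (subtorus_param e b y).
Proof. by move=> b01 ty i; rewrite /subtorus_param; case: pselect. Qed.

(** * Basic properties of the outer measure *)

Lemma box_vol_ge0 (R : realType) (n : nat) (a b : nat -> R) :
  (forall i, (i < n)%N -> a i <= b i) -> 0 <= box_vol n a b.
Proof. by move=> ab; apply: prodr_ge0 => i _; rewrite subr_ge0 ab. Qed.

Lemma sigma_out_ge0 (R : realType) (E : set (nat -> R)) : (0 <= sigma_out E)%E.
Proof.
apply: le_ereal_inf_tmp => _ [n [a [b [ab [_ ->]]]]].
apply: nneseries_ge0 => k _ _; rewrite lee_fin box_vol_ge0// => i ik.
by have [_ []] := ab _ _ ik.
Qed.

Lemma le_sigma_out (R : realType) (E F : set (nat -> R)) :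
  E `<=` F -> (sigma_out E <= sigma_out F)%E.
Proof.
move=> EF; apply: ereal_inf_le_tmp => _ [n [a [b [ab [cov ->]]]]].
by exists n, a, b; split => //; split => //; exact: subset_trans cov.
Qed.

Lemma sigma_out_le1 (R : realType) (E : set (nat -> R)) :
  E `<=` @torus R -> (sigma_out E <= 1)%E.
Proof.
move=> Et; apply: ereal_inf_lbound.
(* Box 0 has dimension 0, so it is the whole torus, of volume 1; the others are one-dimensional with
   side [[0, 0)], of volume 0. *)
exists (fun k => (k != 0)%N : nat), (fun _ _ => 0), (fun _ _ => 0).
split; first by move=> *; rewrite lexx ler01.
split; first by move=> x Ex; exists 0%N => //; split => //; exact: Et.
rewrite nneseries_recl//; last first.
  by move=> k _; rewrite lee_fin box_vol_ge0.
rewrite {1}/box_vol big_ord0 [X in (_ + X)%E](_ : _ = 0%E) ?adde0//.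
rewrite eseries_cond; apply: eseries0 => k _ /= k0.
by rewrite /box_vol -lt0n k0 big_ord_recl subrr mul0r.
Qed.

Lemma sigma_out0 (R : realType) : sigma_out (@set0 (nat -> R)) = 0%E.
Proof.
apply/le_anti; rewrite sigma_out_ge0 andbT; apply: ereal_inf_lbound.
exists (fun=> 1%N), (fun _ _ => 0), (fun _ _ => 0).
split; first by move=> *; rewrite lexx ler01.
split; first exact: sub0set.
by rewrite eseries0// => k _ _; rewrite /box_vol big_ord_recl subrr mul0r.
Qed.

Lemma sigma_out_lt_cover (R : realType) (E : set (nat -> R)) (s : \bar R) :
  (sigma_out E < s)%E -> exists (n : nat -> nat) (a b : nat -> nat -> R), [/\
    (forall k i, (i < n k)%N -> 0 <= a k i /\ a k i <= b k i /\ b k i <= 1),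
    E `<=` \bigcup_k box (n k) (a k) (b k) &
    (\sum_(0 <= k <oo) (box_vol (n k) (a k) (b k))%:E < s)%E].
Proof.
by move=> /ereal_inf_lt[_ [n [a [b [ab [cov ->]]]]] lts]; exists n, a, b.
Qed.

(** The avoiding construction, with [rho = 1] and any [y], supplies a point outside all boxes; so
    [sigma_out] of the torus is at least 1. *)
Lemma not_torus_sub_boxes (R : realType) (n : nat -> nat) (a b : nat -> nat -> R) :
  (forall k i, (i < n k)%N -> 0 <= a k i /\ a k i <= b k i /\ b k i <= 1) ->
  (\sum_(0 <= k <oo) (box_vol (n k) (a k) (b k))%:E < 1%:E)%E ->
  ~ (@torus R `<=` \bigcup_k box (n k) (a k) (b k)).
Proof.
move=> ab vol1 cov.
have [e [b0 [_ _ avoid]]] := exists_avoiding_subtorus _ _ _ _ _ ab vol1 (@ltr01 R).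
have [|z [tz zout _]] := avoid (fun=> 0); first by move=> i; rewrite lexx ltr01.
by have [k _ /zout] := cov z tz.
Qed.

(** Covers of the [E j] of volumes below [w j] merge, along a bijection of [nat] with its square,
    into one of volume at most [1/2]. *)
Lemma not_torus_sub_nulls (R : realType) (E : nat -> set (nat -> R)) :
  (forall j, sigma_null (E j)) -> ~ (@torus R `<=` \bigcup_j E j).
Proof.
move=> Enull.
pose w j : R := 2^-1 / (2 ^ j.+1)%:R.
pose cover j (c : nat -> nat * (nat -> R) * (nat -> R)) := [/\
  (forall k i, (i < (c k).1.1)%N ->
     0 <= (c k).1.2 i /\ (c k).1.2 i <= (c k).2 i /\ (c k).2 i <= 1),
  E j `<=` \bigcup_k box (c k).1.1 (c k).1.2 (c k).2 &
  (\sum_(0 <= k <oo) (box_vol (c k).1.1 (c k).1.2 (c k).2)%:E < (w j)%:E)%E].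
have [c cP] : {c & forall j, cover j (c j)}.
  apply: (@choice _ _ cover) => j.
  have [|n [a [b [ab cov vol]]]] := @sigma_out_lt_cover R (E j) (w j)%:E.
    by rewrite Enull lte_fin divr_gt0 ?invr_gt0// ltr0n expn_gt0.
  by exists (fun k => (n k, a k, b k)).
have /card_esym/ppcard_eqP[h] := card_nat2.
pose v (p : nat * nat) : \bar R :=
  (box_vol (c p.1 p.2).1.1 (c p.1 p.2).1.2 (c p.1 p.2).2)%:E.
have v0 p : (0 <= v p)%E.
  rewrite lee_fin box_vol_ge0// => i ip.
  by have [ab _ _] := cP p.1; have [_ []] := ab p.2 i ip.
move=> Ecov; apply: (@not_torus_sub_boxes R (fun k => (c (h k).1 (h k).2).1.1)
  (fun k => (c (h k).1 (h k).2).1.2) (fun k => (c (h k).1 (h k).2).2)).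
- by move=> k i; have [ab _ _] := cP (h k).1; exact: ab.
- rewrite (@nneseries_esum _ (v \o h) xpredT (fun k _ => v0 (h k))).
  rewrite [X in esum X _](_ : _ = [set: nat]); last by apply/seteqP; split.
  rewrite -(@reindex_esum _ _ _ [set: nat] [set: nat * nat] h v); last exact: bij.
  rewrite (_ : [set: nat * nat] = [set: nat] `*`` (fun=> [set: nat])); last first.
    by apply/seteqP; split.
  rewrite -(@esum_esum _ _ _ _ _ (fun i j => v (i, j)))//.
  apply: (@le_lt_trans _ _ (2^-1)%:E); last by rewrite lte_fin invf_lt1// ltr1n.
  apply: le_trans (epsilon_trick0 xpredT _); last by rewrite invr_ge0.
  rewrite nneseries_esum; last by move=> k _; rewrite lee_fin divr_ge0// invr_ge0.
  rewrite [X in (_ <= esum X _)%E](_ : _ = [set: nat]); last by apply/seteqP; split.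
  apply: le_esum => j _; have [_ _ /ltW] := cP j; apply: le_trans.
  rewrite nneseries_esum; last by move=> k _; exact: (v0 (j, k)).
  by rewrite [X in (_ <= esum X _)%E](_ : _ = [set: nat])//; apply/seteqP; split.
- move=> x tx; have [j _ Ejx] := Ecov x tx; have [_ cov _] := cP j.
  have [k _ xk] := cov x Ejx; exists (h^-1%FUN (j, k)) => //=.
  by rewrite invK ?inE.
Qed.

Lemma sigma_out_fin_num (R : realType) (E : set (nat -> R)) :
  E `<=` @torus R -> sigma_out E \is a fin_num.
Proof.
move=> /sigma_out_le1 E1; rewrite ge0_fin_numE ?sigma_out_ge0//.
by rewrite (le_lt_trans E1)// ltry.
Qed.

(** * An essential value of the function *)

(** The value is the infimum of the levels [r] at which [sub r] has larger outer measure than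
    [sub (- N)], so the measure of [sub] grows strictly between [a - d] and [a + d]. *)
Lemma exists_essential_value (R : realType) (f : (nat -> R) -> R) :
  measurable_torus f -> exists a : R, forall d : R, 0 < d ->
    (sigma_out [set x : nat -> R | torus x /\ ~ (a - d <= f x < a + d)%R] < 1)%E.
Proof.
move=> mf; pose sub r := [set x : nat -> R | torus x /\ f x < r].
have subT r : sub r `<=` @torus R by move=> x [].
have le_sub r s : r <= s -> (sigma_out (sub r) <= sigma_out (sub s))%E.
  by move=> rs; apply: le_sigma_out => x [tx xr]; split=> //; exact: lt_le_trans rs.
(* Otherwise every set where [- N <= f < N] would be null, and these sets cover the torus. *)
have [N gN] : exists N : nat, (sigma_out (sub (- N%:R)%R) < sigma_out (sub N%:R%R))%E.
  apply: contrapT => noN.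
  apply: (@not_torus_sub_nulls R (fun N => sub N%:R `&` ~` sub (- N%:R))) => [N|x tx].
    have [_ /(_ _ (subT N%:R))] := mf (- N%:R).
    rewrite (_ : sub N%:R `&` _ = sub (- N%:R)); last first.
      apply/seteqP; split => [x []//|x [tx xN]]; split => //; split => //.
      by apply: lt_le_trans xN _; rewrite ge0_cp.
    rewrite -/(sub _) => eqN; apply/eqP; rewrite eq_le sigma_out_ge0 andbT.
    rewrite leNgt; apply/negP => pos; apply: noN; exists N.
    by rewrite eqN lteDl// sigma_out_fin_num.
  exists (Num.bound `|f x|) => //; have := archi_boundP (normr_ge0 (f x)).
  rewrite ltr_norml => /andP[fl fr]; split; first by split.
  by case=> _; rewrite ltNge (ltW fl).
pose A := [set r : R | (sigma_out (sub (- N%:R)%R) < sigma_out (sub r))%E].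
have lbA : lbound A (- N%:R).
  move=> r Ar; rewrite leNgt; apply/negP => /ltW /le_sub.
  by rewrite leNgt Ar.
have infA : has_inf A by split; [exists N%:R|exists (- N%:R)].
exists (inf A) => d d0; set a := inf A; set F := [set x | _].
have [r Ar ra] := inf_adherent d0 infA.
have up : (sigma_out (sub (- N%:R)%R) < sigma_out (sub (a + d)%R))%E.
  exact: lt_le_trans Ar (le_sub _ _ (ltW ra)).
have low : (sigma_out (sub (a - d)%R) <= sigma_out (sub (- N%:R)%R))%E.
  rewrite leNgt; apply/negP => Aad.
  have := ge_inf (proj2 infA) Aad; rewrite -/a lerBrDr gerDl leNgt d0//.
have split_by_sub E : E `<=` @torus R -> sigma_out E =
    (sigma_out (E `&` sub (a + d)%R) + sigma_out (E `&` ~` sub (a + d)%R))%E.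
  by have [_] := mf (a + d); exact.
have FT : F `<=` @torus R by move=> x [].
(* [F] splits into [sub (a - d)] and the complement of [sub (a + d)]; replacing the first by
   [sub (a + d)] strictly increases the measure and gives the torus. *)
rewrite (split_by_sub F FT).
rewrite (_ : F `&` sub (a + d) = sub (a - d)); last first.
  apply/seteqP; split => x.
    move=> [[tx nx] [_ xad]]; split=> //; rewrite ltNge; apply/negP => adx.
    by apply: nx; rewrite adx.
  move=> [tx xad]; split; split => //; first by rewrite leNgt xad.
  by apply: lt_trans xad _; rewrite ltrD2l gtrN.
rewrite (_ : F `&` ~` sub (a + d) = @torus R `&` ~` sub (a + d)); last first.
  apply/seteqP; split => x [Fx nx]; first by split=> //; exact: FT Fx.
  by split=> //; split=> // /andP[_ xad]; apply: nx.
apply: (@lt_le_trans _ _ (sigma_out (@torus R))); last exact: sigma_out_le1.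
rewrite [ltRHS](split_by_sub (@torus R))//.
rewrite [X in (_ < sigma_out X + _)%E](_ : _ = sub (a + d)); last exact: setIidr.
rewrite lteD2rE; first exact: le_lt_trans up.
by apply: sigma_out_fin_num => x [].
Qed.

(** * The Lipschitz estimate on the subtorus *)

Theorem theorem1 (R : realType) (f : (nat -> R) -> R) :
  measurable_torus f -> lipschitz_torus f ->
  exists a : R, forall eps : R, 0 < eps ->
    exists (e : nat -> nat) (b : nat -> R),
      (forall k, (e k < e k.+1)%N) /\ (forall i, 0 <= b i < 1) /\
      (Linf_subtorus e b (fun x => (f x - a)%R) < eps%:E)%E.
Proof.
move=> mf [L [L0 Lf]]; have [a aP] := exists_essential_value _ _ mf.
exists a => eps eps0.
(* Two errors of size [d], between [f x] and [f z] and between [f z] and [a], add up to [eps / 2],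
   strictly below [eps]. *)
pose d := eps / 4; have d0 : 0 < d by rewrite divr_gt0.
have [n [c [c' [cc' cov vol]]]] := sigma_out_lt_cover _ _ _ (aP d d0).
(* Dividing by [L + 1] covers the case [L = 0], and [L * (d / (L + 1)) <= d] still holds. *)
have rho0 : 0 < d / (L + 1) by rewrite divr_gt0// ltr_wpDl.
have [e [b [e_incr b01 near_good]]] :=
  exists_avoiding_subtorus _ _ _ _ _ cc' vol rho0.
exists e, b; split=> //; split=> //.
apply: (@le_lt_trans _ _ (d + d)%:E); last first.
  by rewrite lte_fin /d -mulrDl ltr_pdivrMr// mulrDr; lra.
apply: ereal_inf_lbound; exists (d + d) => //.
rewrite /= /sigma_null (_ : [set y | _] = set0) ?sigma_out0//.
apply/seteqP; split => // y [ty] /=; apply/negP; rewrite -leNgt.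
have [z [tz zout xz]] := near_good y ty.
have tx := subtorus_param_torus _ e b y b01 ty.
set x := subtorus_param e b y in xz tx *.
have fz : `|f z - a| <= d.
  have : a - d <= f z < a + d.
    apply: contrapT => zF; have [|k _] := cov z; first by split.
    exact: zout.
  by rewrite ler_distl => /andP[-> /ltW].
have fxz : `|f x - f z| <= d.
  rewrite -(@ler_pXn2r _ 2)// ?nnegrE ?(ltW d0)// -lee_fin.
  apply: le_trans (Lf x z tx tz) _.
  apply: (@le_trans _ _ ((L ^+ 2)%:E * ((d / (L + 1)) ^+ 2)%:E)%E).
    by apply: lee_wpmul2l => //; rewrite lee_fin sqr_ge0.
  rewrite -EFinM lee_fin -exprMn; apply: lerXn2r.
  - by rewrite nnegrE mulr_ge0// ltW.
  - by rewrite nnegrE ltW.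
  by rewrite mulrCA ler_piMr ?(ltW d0)// ler_pdivrMr ?mul1r ?lerDl// ltr_wpDl.
rewrite (_ : f x - a = (f x - f z) + (f z - a)); last by rewrite addrA subrK.
by apply: le_trans (ler_normD _ _) _; exact: lerD.
Qed.
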